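(* For every $n\ge 1$ and every deterministic online algorithm $\mathrm{DET}$ for the online multiple knapsack problem with $n$ bins, the competitive ratio of $\mathrm{DET}$ is at most $R - 1/(52n)$, where $R=1/(1+\ln 2)$; i.e., there exists an input sequence $\sigma$ with $\mathrm{OPT}(\sigma)>0$ and $\mathrm{DET}(\sigma) \le (R - 1/(52n))\cdot \mathrm{OPT}(\sigma)$.
   Context: Online multiple knapsack problem (proportional variant): there are $n$ bins, each of capacity $1$. Items with sizes in $(0,1]$ arrive one at a time. Upon arrival of an item, an online algorithm must irrevocably either reject it or place it into one bin so that no bin's total size exceeds $1$, without knowledge of future items. $A(\sigma)$ is the total size of the items accepted by algorithm $A$ on input $\sigma$; $\mathrm{OPT}(\sigma)$ is the maximum total size of a subset of the items of $\sigma$ that can be feasibly packed into the $n$ bins. An algorithm is $\alpha$-competitive if $A(\sigma)\ge \alpha\cdot\mathrm{OPT}(\sigma)$ for every input $\sigma$; its competitive ratio is the supremum of such $\alpha$. *)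

(* Defs.v *)
From HB Require Import structures.
From mathcomp Require Import all_boot all_order all_algebra.
From mathcomp Require Import all_classical all_reals all_analysis.

Set Implicit Arguments.
Unset Strict Implicit.
Unset Printing Implicit Defensive.

Import Order.TTheory GRing.Theory Num.Theory.
Local Open Scope ring_scope.

Section Knapsack.
Variables (R : realType) (n : nat).
Implicit Types (s : seq R) (j : 'I_n).

Definition is_input s : bool := all (fun x => 0 < x <= 1) s.

(* Items are indexed by their arrival position; [None] means rejected. *)
Definition packing s := {ffun 'I_(size s) -> option 'I_n}.

Definition load s (p : packing s) j : R :=
  \sum_(i < size s | p i == Some j) s`_i.

Definition feasible s (p : packing s) : bool := [forall j, load p j <= 1].

Definition value s (p : packing s) : R :=
  \sum_(i < size s | p i != None) s`_i.

(* The default 0 is the value of the packing that rejects everything. *)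
Definition OPT s : R := \big[Num.max/0]_(p : packing s | feasible p) value p.

(* [d h x] is the decision on item [x] after the items [h] have arrived. The
   earlier decisions of a deterministic algorithm are a function of [h], so
   they need not be passed to [d]. *)
Definition run (d : seq R -> R -> option 'I_n) s : packing s :=
  [ffun i : 'I_(size s) => d (take i s) s`_i].

Record online_algorithm := OnlineAlgorithm {
  decide :> seq R -> R -> option 'I_n;
  run_feasible : forall s, is_input s -> feasible (run decide s) }.

Definition ALG (A : online_algorithm) s : R := value (run A s).

Definition competitive (A : online_algorithm) (alpha : R) : Prop :=
  forall s, is_input s -> alpha * OPT s <= ALG A s.

Definition competitive_ratio (A : online_algorithm) : R :=
  sup [set alpha | competitive A alpha]%classic.

Lemma value_ge0 s (p : packing s) : is_input s -> 0 <= value p.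
Proof.
move=> /allP si; apply: sumr_ge0 => i _.
by have /si/andP[/ltW] := mem_nth 0 (ltn_ord i).
Qed.

Lemma OPT_max s (p : packing s) : feasible p -> value p <= OPT s.
Proof. by move=> fp; rewrite /OPT (bigD1 p) //= le_max lexx. Qed.

Lemma OPT_attained s :
  exists2 p : packing s, feasible p & value p = OPT s.
Proof.
rewrite /OPT; elim/big_ind: _ => [|x y [p fp <-] [q fq <-]|p fp].
- exists [ffun=> None].
    by apply/forallP => j; rewrite /load big1 ?ler01 // => i; rewrite ffunE.
  by rewrite /value big1 // => i; rewrite ffunE.
- by case: (leP (value p) (value q)) => _; [exists q | exists p].
- by exists p.
Qed.

(* [sup] is only meaningful on nonempty sets that are bounded above. *)
Lemma has_sup_competitive (A : online_algorithm) :
  (0 < n)%N -> has_sup [set alpha | competitive A alpha]%classic.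
Proof.
move=> n0; split; first by exists 0 => s si; rewrite mul0r value_ge0.
pose s : seq R := [:: 1].
have si : is_input s by rewrite /is_input /= ltr01 lexx.
exists 1 => a /(_ s si) /le_trans /(_ (OPT_max (run_feasible A si))) h.
have v1 : 1 <= OPT s.
  pose p : packing s := [ffun=> Some (Ordinal n0)].
  have fp : feasible p.
    apply/forallP => j; rewrite /load big_mkcond big_ord1 /=.
    by case: ifP => _; rewrite ?lexx ?ler01.
  apply: le_trans (OPT_max fp).
  by rewrite /value big_mkcond big_ord1 ffunE /=.
by rewrite -(ler_pM2r (lt_le_trans ltr01 v1)) mul1r.
Qed.

End Knapsack.

(* Main.v *)
(** Let [r = 1/(1 + ln 2)]. The adversary sends [n] items of each size of a fine
grid of the interval from 1/2 to 1, in increasing order. No two of them share a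
bin, so at most [n] items are ever accepted, while the optimum after the batch
of size [x] is at least [n x]. Suppose that the algorithm always keeps more than
[alpha] times the optimum, and let [b < alpha n]. If the grid is fine enough,
every item after the first batch is at most [1/b] times the total accepted
before it. With [q = 1 + 1/b], the ratio of the accepted total to
[q ^ (number of accepted items)] therefore never increases, so if [k] items of
the first size are accepted, the final total is at most [(k / q^k) q^n / 2] up
to the mesh of the grid. Since [k ln q <= q^k / e], this is at most [b] for
[b = r n - 1/50], whereas beating [alpha] on the last batch, of items of size 1,
requires more than [alpha n]. *)

Require Import Defs.
From mathcomp Require Import all_boot all_order all_algebra.
From mathcomp Require Import all_classical all_reals all_analysis.
From mathcomp Require Import ring lra.

Set Implicit Arguments.
Unset Strict Implicit.
Unset Printing Implicit Defensive.

Import Order.TTheory GRing.Theory Num.Theory.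
Import numFieldNormedType.Exports.
Local Open Scope ring_scope.

Section LogarithmBounds.
Variable R : realType.
Implicit Types b q x : R.

Lemma ln_ge_1BV x : 0 < x -> 1 - x^-1 <= ln x.
Proof.
move=> x0; have := @le_ln1Dx R (x^-1 - 1).
by rewrite addrCA subrr addr0 lnV ?posrE // ltrBrDl subrr invr_gt0 x0; lra.
Qed.

Lemma ln_le_half_subrV x : 1 <= x -> ln x <= (x - x^-1) / 2.
Proof.
move=> x1; pose f (z : R) := z - z^-1 - 2 * ln z.
have df (z : R) : 0 < z -> is_derive z 1 f ((1 - z^-1) ^+ 2).
  move=> z0; have zn0 : z != 0 by rewrite gt_eqF.
  have dV : is_derive z 1 (fun w : R => w^-1) (- z ^- 2 *: 1).
    exact: (@is_deriveV _ id).
  have dln := is_derive1_ln z0.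
  by apply: is_derive_eq; rewrite -exprVn /GRing.scale /=; ring.
have cc_gt0 (z : R) : z \in `[1, x]%R -> 0 < z by rewrite in_itv /=; lra.
have oo_gt0 (z : R) : z \in `]1, x[%R -> 0 < z.
  by move=> /(@subset_itv_oo_cc _ _ _ _ _); apply: cc_gt0.
suff : f 1 <= f x by rewrite /f invr1 ln1; lra.
apply: (@ger0_derive1_le_cc _ f 1 x) => //; rewrite ?in_itv /= ?lexx ?x1 //.
- by move=> z /oo_gt0/df[].
- by move=> z /oo_gt0/df dz; rewrite derive1E derive_val sqr_ge0.
- by apply: derivable_within_continuous => z /cc_gt0/df[].
Qed.

Lemma ln_ge_half_subrV x : 0 < x <= 1 -> (x - x^-1) / 2 <= ln x.
Proof.
move=> /andP[x0 x1]; have := @ln_le_half_subrV x^-1.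
by rewrite invrK lnV ?posrE // invf_ge1 // => /(_ x1); lra.
Qed.

Lemma ln2_bounds : 7 / 12 <= ln (2 : R) <= 3 / 4.
Proof.
have ln2_le : ln (2 : R) <= (2 - 2^-1) / 2 by apply: ln_le_half_subrV; lra.
have ln32_ge : 1 - (3 / 2 : R)^-1 <= ln (3 / 2) by apply: ln_ge_1BV; lra.
have ln43_ge : 1 - (4 / 3 : R)^-1 <= ln (4 / 3) by apply: ln_ge_1BV; lra.
have ln2E : ln (2 : R) = ln (3 / 2) + ln (4 / 3).
  by rewrite -lnM ?posrE; [congr ln; field | lra | lra].
by move: ln32_ge ln43_ge; rewrite !invf_div; lra.
Qed.

Lemma mul_ln1DV_bounds b : 0 < b ->
  b / (b + 1) <= b * ln (1 + b^-1) <= 1 - (2 * (b + 1))^-1.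
Proof.
move=> b0; have bV0 : 0 < b^-1 by rewrite invr_gt0.
have ln_ge : 1 - (1 + b^-1)^-1 <= ln (1 + b^-1) by apply: ln_ge_1BV; lra.
have ln_le : ln (1 + b^-1) <= (1 + b^-1 - (1 + b^-1)^-1) / 2.
  by apply: ln_le_half_subrV; lra.
have lowerE : b / (b + 1) = b * (1 - (1 + b^-1)^-1).
  by field; rewrite !gt_eqF //; lra.
have upperE : 1 - (2 * (b + 1))^-1 = b * ((1 + b^-1 - (1 + b^-1)^-1) / 2).
  by field; rewrite !gt_eqF //; lra.
by rewrite lowerE upperE !ler_pM2l // ln_ge.
Qed.

(* With [v = b ln (1 + 1/b)], which is [1 - 1/(2b) + o(1/b)], the bound
   [ln v >= (v - 1/v) / 2] leaves [(1 - v) (ln 2 - 1/(2b))] to absorb the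
   perturbation [1/50]. *)
Lemma ln_mul_ln1DV_ge b (u := ln (1 + b^-1)) : 11 / 10 <= b ->
  (1 + ln 2) * ((b + 1 / 50) * u - 1) <= ln (b * u).
Proof.
move=> b_ge; have b0 : 0 < b by lra.
have bV0 : 0 < b^-1 by rewrite invr_gt0.
have /andP[L_ge L_le] := ln2_bounds; set L := ln 2 in L_ge L_le *.
have := mul_ln1DV_bounds b0; rewrite -/u; set v := b * u => /andP[v_ge v_le].
have v0 : 0 < v by apply: lt_le_trans v_ge; rewrite divr_gt0 //; lra.
have gap_ge : (2 * (b + 1))^-1 <= 1 - v by lra.
have gap0 : 0 < 1 - v by apply: lt_le_trans gap_ge; rewrite invr_gt0; lra.
have vV_le : v^-1 <= 1 + b^-1.
  have -> : 1 + b^-1 = (b / (b + 1))^-1 by field; rewrite !gt_eqF //; lra.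
  by rewrite lef_pV2 // posrE divr_gt0 //; lra.
have loss_le : (1 + L) / 50 * u <= (1 - v) * (L - b^-1 / 2).
  have u_le : u <= b^-1 by apply: le_ln1Dx; lra.
  apply: (@le_trans _ _ ((1 + L) / 50 * b^-1)); first by rewrite ler_wpM2l; lra.
  have -> : L - b^-1 / 2 = (L * b - 1 / 2) * b^-1 by field; rewrite gt_eqF.
  rewrite mulrA ler_pM2r //.
  apply: (@le_trans _ _ ((2 * (b + 1))^-1 * (L * b - 1 / 2))).
    by rewrite ler_pdivlMl; nra.
  by rewrite ler_wpM2r //; nra.
have lnv_ge : - ((1 - v) * (1 + b^-1 / 2)) <= ln v.
  apply: le_trans (_ : (v - v^-1) / 2 <= _); last first.
    by apply: ln_ge_half_subrV; lra.
  have -> : (v - v^-1) / 2 = - ((1 - v) * (1 + v^-1) / 2).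
    by field; rewrite gt_eqF.
  by rewrite lerN2 -mulrA ler_pM2l //; lra.
by have -> : (b + 1 / 50) * u = v + u / 50 by [rewrite /v; ring]; lra.
Qed.

Lemma natr_mul_ln_le k q : 0 < q -> k%:R * ln q <= q ^+ k / expR 1.
Proof.
move=> q0; rewrite -[q in leRHS](lnK q0) -expRM_natl -expRB.
by have := expR_ge1Dx (k%:R * ln q - 1); lra.
Qed.

Lemma natr_div_exprn_le n k b (q := 1 + b^-1) :
    (0 < n)%N -> (k <= n)%N -> n%:R <= (1 + ln 2) * (b + 1 / 50) ->
  k%:R / q ^+ k * q ^+ n <= 2 * b.
Proof.
move=> n0 kn n_le; have /andP[L_ge L_le] := ln2_bounds.
have [n_le1|n_ge2] := leqP n 1.
  have {n0 n_le1}nE : n = 1%N by apply/eqP; rewrite eqn_leq n_le1 n0.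
  move: kn n_le; rewrite {}nE; case: k => [|[|//]] _ n_le.
    by rewrite !mul0r; nra.
  have b_ge : 1 / 2 <= b by nra.
  by rewrite divfK ?gt_eqF ?expr1 /q ?addr_gt0 ?invr_gt0 //; lra.
have {}n_ge2 : 2 <= n%:R :> R by rewrite (ler_nat _ 2).
have b_ge : 11 / 10 <= b by nra.
have b0 : 0 < b by lra.
have q1 : 1 < q by rewrite /q ltrDl invr_gt0.
have q0 : 0 < q by lra.
have u0 : 0 < ln q by rewrite ln_gt0.
have k_le : k%:R / q ^+ k <= (expR 1 * ln q)^-1.
  rewrite ler_pdivrMr ?exprn_gt0 // ler_pdivlMl ?mulr_gt0 ?expR_gt0 //.
  by rewrite -mulrA -ler_pdivlMl ?expR_gt0 // mulrC [leRHS]mulrC natr_mul_ln_le.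
have lnb_ge : n%:R * ln q - 1 <= ln (2 * (b * ln q)).
  rewrite lnM ?posrE ?mulr_gt0 //.
  by have := ln_mul_ln1DV_ge b_ge; rewrite -/q; nra.
apply: le_trans (ler_wpM2r (exprn_ge0 n (ltW q0)) k_le) _.
rewrite -[q in q ^+ n](lnK q0) -expRM_natl ler_pdivrMl ?mulr_gt0 ?expR_gt0 //.
have -> : expR 1 * ln q * (2 * b) = expR (1 + ln (2 * (b * ln q))).
  by rewrite expRD lnK ?posrE ?mulr_gt0 //; ring.
by rewrite ler_expR; lra.
Qed.

End LogarithmBounds.

Section Packings.
Variables (R : realType) (n : nat).
Implicit Types s : seq R.

Lemma value_sum_load s (p : packing n s) : value p = \sum_j load p j.
Proof.
rewrite /load (exchange_big_dep (fun i => p i != None)) => [|j i _ /eqP-> //].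
apply: eq_bigr => i; case: (p i) => [j|//] _.
by rewrite (big_pred1 j) // => j'; rewrite /= eq_sym.
Qed.

Lemma OPT_cat_nseq_ge s x :
  0 <= x <= 1 -> n%:R * x <= OPT n (s ++ nseq n x).
Proof.
move=> /andP[x0 x1].
have ltn_size (j : 'I_n) : (size s + j < size (s ++ nseq n x))%N.
  by rewrite size_cat size_nseq ltn_add2l.
pose p : packing n (s ++ nseq n x) :=
  [ffun i => [pick j : 'I_n | i == Ordinal (ltn_size j)]].
have pE i j : (p i == Some j) = (i == Ordinal (ltn_size j)).
  rewrite ffunE; case: pickP => [j' /eqP ->|/(_ j) -> //].
  by rewrite -val_eqE /= eqn_add2l.
have loadE j : load p j = x.
  rewrite /load (big_pred1 (Ordinal (ltn_size j))) => [|i]; last exact: pE.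
  by rewrite /= nth_cat ltnNge leq_addr /= addKn nth_nseq ltn_ord.
have feas : feasible p by apply/forallP => j; rewrite loadE.
apply: le_trans (OPT_max feas); rewrite value_sum_load.
by under eq_bigr do rewrite loadE; rewrite sumr_const card_ord mulr_natl.
Qed.

Lemma card_packed_le s (p : packing n s) :
    feasible p -> all (fun x => 1 / 2 < x) s ->
  (#|[pred i | p i != None]| <= n)%N.
Proof.
move=> /forallP feas /all_nthP big.
have item_gt (i : 'I_(size s)) : 1 / 2 < s`_i by apply: big.
have p_inj : {in [pred i | p i != None] &, injective p}.
  move=> i i'; rewrite !inE => pi_neq0 _ p_eq; apply/eqP/negPn/negP => neq_ii'.
  case pi_eq: (p i) pi_neq0 => [j|//] _.
  have := feas j; rewrite leNgt => /negP; apply.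
  rewrite /load (bigD1 i) ?pi_eq //= (bigD1 i') /=; last first.
    by rewrite -p_eq pi_eq eqxx eq_sym.
  rewrite addrA -[ltLHS]addr0 ltr_leD //.
    by have := item_gt i; have := item_gt i'; lra.
  by apply: sumr_ge0 => i0 _; have := item_gt i0; lra.
rewrite -(card_in_imset p_inj) -[leqRHS]card_ord -[leqRHS]/(#|'I_n|.+1.-1).
rewrite -card_option -(cardC1 (None : option 'I_n)); apply/subset_leq_card.
by apply/fintype.subsetP => o /imsetP[i pi_neq0 ->].
Qed.

End Packings.

Section OnlineRuns.
Variables (R : realType) (n : nat) (A : online_algorithm R n).
Implicit Types (s : seq R) (alpha q x : R).

Lemma competitive_ratio_le alpha s :
    (0 < n)%N -> is_input s -> 0 < OPT n s -> ALG A s <= alpha * OPT n s ->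
  competitive_ratio A <= alpha.
Proof.
move=> n0 s_in OPT0 ALG_le; apply: ge_sup => [|beta /(_ s s_in) beta_le].
  by case: (has_sup_competitive A n0).
by rewrite -(ler_pM2r OPT0) (le_trans beta_le).
Qed.

Definition strictly_competitive alpha : Prop :=
  forall s, is_input s -> 0 < OPT n s -> alpha * OPT n s < ALG A s.

Lemma not_strictly_competitive alpha : ~ strictly_competitive alpha ->
  exists s, [/\ is_input s, 0 < OPT n s & ALG A s <= alpha * OPT n s].
Proof.
move=> ncomp; apply: contrapT => nex; apply: ncomp => s s_in OPT0.
by rewrite ltNge; apply/negP => ALG_le; apply: nex; exists s.
Qed.

Definition accepted s : nat := #|[pred i | run A s i != None]|.

Lemma accepted_le s : all (fun x => 1 / 2 < x <= 1) s -> (accepted s <= n)%N.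
Proof.
move=> s12; apply: card_packed_le.
  by apply/run_feasible/(sub_all _ s12) => x; lra.
by apply: (sub_all _ s12) => x; lra.
Qed.

Lemma sum_run_rcons (V : nmodType) (F : R -> V) s x :
  \sum_(i < size (rcons s x) | run A (rcons s x) i != None) F (rcons s x)`_i =
  \sum_(i < size s | run A s i != None) F s`_i + F x *+ (A s x != None).
Proof.
have runE s' : \sum_(i < size s' | run A s' i != None) F s'`_i =
    \sum_(0 <= i < size s' | A (take i s') s'`_i != None) F s'`_i.
  by rewrite big_mkord; apply: eq_bigl => i; rewrite ffunE.
rewrite !runE size_rcons big_mkcond big_nat_recr //= -big_mkcond /=.
rewrite nth_rcons ltnn eqxx -cats1 take_size_cat // mulrb; congr (_ + _).
rewrite big_nat_cond [RHS]big_nat_cond.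
apply: eq_big => [i|i /andP[/andP[_ i_lt] _]]; last by rewrite nth_cat i_lt.
by case: ltnP => //= i_lt; rewrite takel_cat ?(ltnW i_lt) // nth_cat i_lt.
Qed.

Lemma ALG_rcons s x : ALG A (rcons s x) = ALG A s + x *+ (A s x != None).
Proof. exact: (sum_run_rcons id). Qed.

Lemma accepted_rcons s x :
  accepted (rcons s x) = (accepted s + (A s x != None))%N.
Proof.
by rewrite /accepted -!sum1_card (sum_run_rcons (fun=> 1%N)); case: (A s x).
Qed.

Lemma ALG_nseq m x : ALG A (nseq m x) = (accepted (nseq m x))%:R * x.
Proof.
rewrite mulr_natl /accepted -sum1_card -sumrMnr; apply: eq_bigr => i _.
by rewrite nth_nseq -[X in (_ < X)%N](size_nseq m x) ltn_ord.
Qed.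

Lemma ALG_cat_ge s1 s2 :
  all (fun x => 0 <= x) s2 -> ALG A s1 <= ALG A (s1 ++ s2).
Proof.
elim/last_ind: s2 => [|s2 x IH]; first by rewrite cats0.
rewrite all_rcons -rcons_cat ALG_rcons => /andP[x0 /IH ALG_le].
by rewrite (le_trans ALG_le) // lerDl mulrn_wge0.
Qed.

Definition discounted_ALG q s : R := ALG A s / q ^+ accepted s.

Lemma discounted_ALG_rcons_le q s x :
    0 < q -> x <= (q - 1) * ALG A s ->
  discounted_ALG q (rcons s x) <= discounted_ALG q s.
Proof.
move=> q0 x_le; rewrite /discounted_ALG ALG_rcons accepted_rcons.
case: (A s x) => [j|]; last by rewrite addr0 addn0.
rewrite addn1 exprS invfM mulrA ler_pM2r ?invr_gt0 ?exprn_gt0 //.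
by rewrite ler_pdivrMr // mulr1n; lra.
Qed.

Lemma discounted_ALG_cat_nseq_le q s m x :
    1 <= q -> 0 <= x <= (q - 1) * ALG A s ->
  discounted_ALG q (s ++ nseq m x) <= discounted_ALG q s.
Proof.
move=> q1 /andP[x0 x_le]; elim: m => [|m IH]; first by rewrite cats0.
rewrite -addn1 nseqD catA cats1 (le_trans _ IH) // discounted_ALG_rcons_le //.
  by lra.
rewrite (le_trans x_le) // ler_wpM2l ?subr_ge0 // ALG_cat_ge //.
by rewrite all_nseq x0 orbT.
Qed.

End OnlineRuns.

Section Batches.
Variables (R : realType) (n : nat).
Implicit Types (x : nat -> R) (M : nat).

Fixpoint batches x M : seq R :=
  if M is M'.+1 then batches x M' ++ nseq n (x M') else [::].

Lemma all_batches (P : pred R) x M :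
  (forall i, (i < M)%N -> P (x i)) -> all P (batches x M).
Proof.
elim: M => //= M IH Px; rewrite all_cat all_nseq Px ?orbT ?andbT //.
by apply: IH => i iM; rewrite Px // ltnW.
Qed.

Variable A : online_algorithm R n.

Lemma discounted_ALG_batches_le q x M : 1 <= q ->
    (forall i, (i < M)%N -> 0 <= x i.+1 <= (q - 1) * ALG A (batches x i.+1)) ->
  discounted_ALG A q (batches x M.+1) <= discounted_ALG A q (nseq n (x 0)).
Proof.
move=> q1; elim: M => // M IH x_le.
apply: le_trans (IH _) => [|i iM]; last by rewrite x_le // ltnW.
exact: discounted_ALG_cat_nseq_le (x_le M _).
Qed.

Lemma ALG_batches_le q x M (k := accepted A (nseq n (x 0))) : 1 <= q ->
    (forall i, (i <= M)%N -> 1 / 2 < x i <= 1) ->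
    (forall i, (i < M)%N -> x i.+1 <= (q - 1) * ALG A (batches x i.+1)) ->
  ALG A (batches x M.+1) <= x 0 * (k%:R / q ^+ k * q ^+ n).
Proof.
move=> q1 x12 x_le; have q0 : 0 < q by lra.
have disc_le : discounted_ALG A q (batches x M.+1) <= x 0 * (k%:R / q ^+ k).
  rewrite mulrCA mulrA -ALG_nseq; apply: discounted_ALG_batches_le => // i iM.
  by rewrite x_le // andbT; have := x12 _ iM; lra.
have acc_le : (accepted A (batches x M.+1) <= n)%N.
  by apply: accepted_le; apply: all_batches.
have ALGE : ALG A (batches x M.+1) =
    discounted_ALG A q (batches x M.+1) * q ^+ accepted A (batches x M.+1).
  by rewrite divfK // gt_eqF ?exprn_gt0.
rewrite {}ALGE mulrA.
apply: le_trans (ler_wpM2r (exprn_ge0 _ (ltW q0)) disc_le) _.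
rewrite ler_wpM2l ?ler_weXn2l // mulr_ge0 ?divr_ge0 ?exprn_ge0 ?(ltW q0) //.
by have := x12 0 isT; lra.
Qed.

Lemma strictly_competitive_batches alpha x M :
    (0 < n)%N -> 0 <= alpha -> strictly_competitive A alpha ->
    (forall i, (i <= M)%N -> 0 < x i <= 1) ->
  alpha * n%:R * x M < ALG A (batches x M.+1).
Proof.
move=> n0 alpha0 comp x01; have /andP[x0 x1] := x01 _ (leqnn M).
have OPT_ge : n%:R * x M <= OPT n (batches x M.+1).
  by apply: OPT_cat_nseq_ge; rewrite (ltW x0).
apply: le_lt_trans (comp (batches x M.+1) _ _).
- by rewrite -mulrA ler_wpM2l.
- exact: all_batches.
- by apply: lt_le_trans OPT_ge; rewrite mulr_gt0 ?ltr0n.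
Qed.

End Batches.

Section Grid.
Variable R : realType.
Implicit Types M i : nat.

Definition grid M i : R := (1 + i.+1%:R / M.+1%:R) / 2.

Lemma grid_itv M i : (i <= M)%N -> 1 / 2 < grid M i <= 1.
Proof.
move=> iM; rewrite /grid; set frac := _ / M.+1%:R.
have frac0 : 0 < frac by rewrite divr_gt0 ?ltr0n.
have frac1 : frac <= 1 by rewrite ler_pdivrMr ?ltr0n // mul1r ler_nat.
by lra.
Qed.

Lemma grid_last M : grid M M = 1.
Proof. by rewrite /grid divff ?pnatr_eq0 //; lra. Qed.

Lemma gridS_le M i : grid M i.+1 <= 2 * grid M 0 * grid M i.
Proof.
rewrite /grid -[i.+2%:R]natr1 [_ / M.+1%:R in leLHS]mulrDl !mul1r.
set mesh := M.+1%:R^-1; set frac := i.+1%:R * mesh.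
have mesh_frac_ge0 : 0 <= mesh * frac by rewrite !mulr_ge0 ?invr_ge0.
by lra.
Qed.

Lemma grid0_le (c : R) : 1 < c -> exists M, 2 * grid M 0 <= c.
Proof.
move=> c1; exists (Num.bound (c - 1)^-1).
have cV0 : 0 < (c - 1)^-1 by rewrite invr_gt0 subr_gt0.
set M := Num.bound _.
have M_gt : (c - 1)^-1 < M.+1%:R.
  by apply: lt_trans (archi_boundP (ltW cV0)) _; rewrite ltr_nat.
rewrite /grid mul1r; set mesh := M.+1%:R^-1.
have mesh_le : mesh <= c - 1.
  by rewrite -[leRHS]invrK lef_pV2 ?posrE ?ltr0n // ltW.
by lra.
Qed.

End Grid.

Lemma strictly_competitive_le (R : realType) (n : nat)
    (A : online_algorithm R n) (alpha b : R) (q := 1 + b^-1) :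
    (0 < n)%N -> 0 < b ->
    (forall k, (k <= n)%N -> k%:R / q ^+ k * q ^+ n <= 2 * b) ->
  strictly_competitive A alpha -> alpha * n%:R <= b.
Proof.
move=> n0 b0 growth comp; rewrite leNgt; apply/negP => b_lt.
have alpha0 : 0 <= alpha by rewrite -(@pmulr_lge0 _ n%:R) ?ltr0n //; lra.
have [M mesh_le] : exists M, 2 * grid R M 0 <= alpha * n%:R / b.
  by apply: grid0_le; rewrite ltr_pdivlMr // mul1r.
have {}mesh_le : 2 * grid R M 0 * b <= alpha * n%:R by rewrite -ler_pdivlMr.
have grid_ge0 i : (i <= M)%N -> 0 <= grid R M i.
  by move=> iM; have := grid_itv R iM; lra.
pose s i := batches n (grid R M) i.+1.
have ALG_gt i : (i <= M)%N -> alpha * n%:R * grid R M i < ALG A (s i).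
  move=> iM; apply: strictly_competitive_batches => // j ji.
  by have := grid_itv R (leq_trans ji iM); lra.
have next_le i : (i < M)%N -> grid R M i.+1 <= (q - 1) * ALG A (s i).
  move=> iM; rewrite /q addrAC subrr add0r ler_pdivlMl //.
  apply: le_trans (ltW (ALG_gt i (ltnW iM))).
  apply: le_trans (ler_wpM2l (ltW b0) (gridS_le R M i)) _.
  by rewrite mulrA [b * _]mulrC ler_wpM2r // grid_ge0 // ltnW.
have q1 : 1 <= q by rewrite lerDl invr_ge0 ltW.
have ALG_le : ALG A (s M) <= grid R M 0 * (2 * b).
  apply: le_trans (ALG_batches_le q1 (@grid_itv R M) next_le) _.
  rewrite ler_wpM2l ?grid_ge0 ?growth // accepted_le //.
  by rewrite all_nseq grid_itv ?orbT.
by have := ALG_gt M (leqnn M); rewrite grid_last; lra.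
Qed.

Theorem theorem28 (R : realType) (n : nat) (hn : (1 <= n)%N)
    (DET : online_algorithm R n) :
  competitive_ratio DET <= 1 / (1 + ln (2 : R)) - 1 / (52 * n%:R) /\
  exists sigma : seq R,
    [/\ is_input sigma,
        0 < OPT n sigma &
        ALG DET sigma <=
          (1 / (1 + ln (2 : R)) - 1 / (52 * n%:R)) * OPT n sigma].
Proof.
set alpha := 1 / (1 + ln 2) - _.
have /andP[L_ge L_le] := ln2_bounds R.
have n1 : 1 <= n%:R :> R by rewrite ler1n.
pose b : R := n%:R / (1 + ln 2) - 1 / 50.
have nE : n%:R = (1 + ln 2) * (b + 1 / 50) :> R by rewrite /b; field; lra.
have alphaE : alpha * n%:R = b + 1 / 50 - 1 / 52.
  by rewrite /alpha /b; field; rewrite !gt_eqF //; lra.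
have b0 : 0 < b by nra.
have growth k : (k <= n)%N ->
    k%:R / (1 + b^-1) ^+ k * (1 + b^-1) ^+ n <= 2 * b.
  by move=> kn; apply: natr_div_exprn_le; rewrite // nE.
have ncomp : ~ strictly_competitive DET alpha.
  by move=> /(strictly_competitive_le hn b0 growth); rewrite alphaE; lra.
have [s [s_in OPT0 ALG_le]] := not_strictly_competitive ncomp.
by split; [exact: competitive_ratio_le ALG_le | exists s].
Qed.
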